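(* Let $(S;\wedge,\vee)$ be a skew lattice and let $A>B$ be comparable $\mathcal{D}$-classes of $S$. Then every coset $A\wedge b\wedge A$ of $A$ in $B$ ($b\in B$) and every image set $a\wedge B\wedge a$ of an element $a\in A$ in $B$ is closed under $\wedge$ and $\vee$ and is a rectangular subalgebra of $B$; dually, every coset $B\vee a\vee B$ of $B$ in $A$ ($a\in A$) and every image set $b\vee A\vee b$ of an element $b\in B$ in $A$ is closed under $\wedge$ and $\vee$ and is a rectangular subalgebra of $A$. Moreover, for all $a\in A$ and $b\in B$ the coset bijection $\varphi_{a,b}: B\vee a\vee B\to A\wedge b\wedge A$ is an isomorphism (with respect to both $\wedge$ and $\vee$).
   Context: A skew lattice is a set $S$ with associative idempotent binary operations $\wedge,\vee$ satisfying the absorption laws $x\wedge(x\vee y)=x=(y\vee x)\wedge x$ and their duals $x\vee(x\wedge y)=x=(y\wedge x)\vee x$. A band is a semigroup of idempotents; it is rectangular if it satisfies $xyx=x$. A skew lattice is rectangular if both $(S;\wedge)$ and $(S;\vee)$ are rectangular bands. The natural partial order on $S$: $x\geq y$ iff $x\wedge y=y=y\wedge x$ (equivalently $x\vee y=x=y\vee x$). The natural preorder: $x\succeq y$ iff $y\wedge x\wedge y=y$ (equivalently $x\vee y\vee x=x$). The relation $\mathcal{D}$ is given by $x\,\mathcal{D}\,y$ iff $x\succeq y$ and $y\succeq x$. It is a congruence, $S/\mathcal{D}$ is a lattice, and each $\mathcal{D}$-class is a maximal rectangular sub-skew lattice. For $\mathcal{D}$-classes, $A>B$ means $A>B$ in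 the lattice $S/\mathcal{D}$. For $\mathcal{D}$-classes $A>B$: a coset of $A$ in $B$ is a set $A\wedge b\wedge A=\{a\wedge b\wedge a\mid a\in A\}$ with $b\in B$; a coset of $B$ in $A$ is a set $B\vee a\vee B=\{b\vee a\vee b\mid b\in B\}$ with $a\in A$. The image set of $a\in A$ in $B$ is $a\wedge B\wedge a=\{a\wedge b\wedge a\mid b\in B\}=\{b\in B\mid b<a\}$; the image set of $b\in B$ in $A$ is $b\vee A\vee b=\{b\vee a\vee b\mid a\in A\}=\{a\in A\mid b<a\}$. It is known that for all $a\in A$, $b\in B$ there is a bijection $\varphi_{a,b}:B\vee a\vee B\to A\wedge b\wedge A$, called a coset bijection, determined by: $\varphi_{a,b}(x)=y$ iff $x\geq y$ (for $x\in B\vee a\vee B$, $y\in A\wedge b\wedge A$); explicitly $\varphi_{a,b}(x)=x\wedge b\wedge x$. *)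

(* Defs.v *)
From HB Require Import structures.
From mathcomp Require Import all_boot.
From mathcomp Require Import boolp classical_sets functions.

Set Implicit Arguments.
Unset Strict Implicit.
Unset Printing Implicit Defensive.

Local Open Scope classical_set_scope.

Reserved Notation "x ⊓ y" (at level 48, left associativity).
Reserved Notation "x ⊔ y" (at level 48, left associativity).

HB.mixin Record isSkewLattice (S : Type) := {
  smeet : S -> S -> S;
  sjoin : S -> S -> S;
  smeetA : associative smeet;
  sjoinA : associative sjoin;
  smeetxx : idempotent_op smeet;
  sjoinxx : idempotent_op sjoin;
  smeetKj : forall x y, smeet x (sjoin x y) = x;
  sjoinKm_r : forall x y, smeet (sjoin y x) x = x;
  sjoinKm : forall x y, sjoin x (smeet x y) = x;
  smeetKj_r : forall x y, sjoin (smeet y x) x = x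
}.

#[short(type="skewLatticeType")]
HB.structure Definition SkewLattice := { S of isSkewLattice S }.

Notation "x ⊓ y" := (smeet x y).
Notation "x ⊔ y" := (sjoin x y).

Section Bands.
Variable T : Type.
Implicit Types (op : T -> T -> T) (X : set T).

Definition closed_under op X : Prop :=
  forall x y, X x -> X y -> X (op x y).

Definition band_on op X : Prop :=
  [/\ closed_under op X,
      forall x y z, X x -> X y -> X z -> op x (op y z) = op (op x y) z
    & forall x, X x -> op x x = x].

Definition rectangular_band_on op X : Prop :=
  band_on op X /\ forall x y, X x -> X y -> op (op x y) x = x.

End Bands.

Section SkewLatticeTheory.
Variable S : skewLatticeType.
Implicit Types (x y a b : S) (A B X Y : set S).

Definition nat_ge x y : Prop := x ⊓ y = y /\ y ⊓ x = y.

Definition nat_succeq x y : Prop := y ⊓ x ⊓ y = y.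

Definition relD x y : Prop := nat_succeq x y /\ nat_succeq y x.

Definition is_Dclass A : Prop := exists x, A = [set y | relD x y].

(* The meet of the quotient lattice S/D, whose elements are D-classes. *)
Definition Dmeet A B : set S :=
  [set z | exists x y, [/\ A x, B y & relD (x ⊓ y) z]].

Definition Dge A B : Prop := Dmeet A B = B.

Definition Dgt A B : Prop := Dge A B /\ A <> B.

Definition subalgebra X : Prop :=
  closed_under (@smeet S) X /\ closed_under (@sjoin S) X.

(* The absorption laws of the subalgebra are inherited from S. *)
Definition rectangular_subalgebra B X : Prop :=
  [/\ X `<=` B, subalgebra X,
      rectangular_band_on (@smeet S) X & rectangular_band_on (@sjoin S) X].

Definition meet_coset A b : set S := [set a ⊓ b ⊓ a | a in A].

Definition join_coset B a : set S := [set b ⊔ a ⊔ b | b in B].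

Definition meet_image B a : set S := [set a ⊓ b ⊓ a | b in B].

Definition join_image A b : set S := [set b ⊔ a ⊔ b | a in A].

(* As a total function on S the coset bijection phi_(a,b) depends on b only;
   the element a enters through its domain join_coset B a. *)
Definition coset_bijection b x : S := x ⊓ b ⊓ x.

Definition isomorphism_on X Y (f : S -> S) : Prop :=
  [/\ set_bij X Y f,
      forall x y, X x -> X y -> f (x ⊓ y) = f x ⊓ f y
    & forall x y, X x -> X y -> f (x ⊔ y) = f x ⊔ f y].

End SkewLatticeTheory.

(* Main.v *)
(** Everything rests on one identity: if [a], [a'] lie in the upper class [A]
    and [b] in the lower class [B], then [a ⊓ a' ⊓ b = a ⊓ b], because
    [w := b ⊔ a' ⊔ b] lies in [A] and satisfies [w ⊓ b = b], while
    [a ⊓ a' ⊓ w = a ⊓ w] in the rectangular band [A].  Together with its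
    mirror image it shows that the meet of two members of a coset is again of
    the form [d ⊓ b ⊓ d], and that [x ⊓ b ⊓ x] is the only member of
    [A ⊓ b ⊓ A] below [x].  Joins need no separate treatment, since
    [x ⊔ y = y ⊓ x] inside a D-class.  The order dual of a skew lattice is a
    skew lattice, with the roles of [A] and [B] exchanged. *)

Require Import Defs.
From HB Require Import structures.
From mathcomp Require Import all_boot.
From mathcomp Require Import boolp classical_sets functions.

Set Implicit Arguments.
Unset Strict Implicit.
Unset Printing Implicit Defensive.

Local Open Scope classical_set_scope.

(** Writing [op] as juxtaposition, [z = pxq] gives [zxqpz = pxqxqpxq = pxqpxq = z], hence
    [zxz = zx(zxqpz) = (zx)(zx)qpz = z]. Used below for both [⊓] and [⊔]. *)
Lemma band_sandwich (T : Type) (op : T -> T -> T) (p x q z : T) :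
  associative op -> idempotent_op op -> z = op (op p x) q ->
  op (op z x) z = z.
Proof.
move=> opA opxx zE.
have op2 u v : op (op u v) v = op u v by rewrite -opA opxx.
have op4 u v w : op (op (op (op u v) w) v) w = op (op u v) w.
  by rewrite -!(opA _ v w) op2.
have zxqpz : op (op (op (op z x) q) p) z = z.
  by rewrite zE !opA op4 op2 -[RHS]opxx !opA.
by rewrite -{2}zxqpz !opA -(opA _ z x) opxx.
Qed.

(** A copy of [T] that carries the order dual without competing with the structure already there. It
    unfolds to [T], so facts about the dual transfer by conversion. *)
Definition dual_skew (T : Type) : Type := T.

HB.instance Definition _ (S : skewLatticeType) :=
  isSkewLattice.Build (dual_skew S) (@sjoinA S) (@smeetA S) (@sjoinxx S)
    (@smeetxx S) (@sjoinKm S) (@smeetKj_r S) (@smeetKj S) (@sjoinKm_r S).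

(** * The natural preorder and its dual form *)

Section Preorder.
Variable S : skewLatticeType.
Implicit Types x y z : S.

Lemma smeet2 x y : x ⊓ y ⊓ y = x ⊓ y.
Proof. by rewrite -smeetA smeetxx. Qed.

Lemma smeet4 x y z : x ⊓ y ⊓ z ⊓ y ⊓ z = x ⊓ y ⊓ z.
Proof. by rewrite -!(smeetA _ y z) smeet2. Qed.

Lemma sjoin_smeet_eq x y : x ⊔ y = y <-> x ⊓ y = x.
Proof. by split=> <-; rewrite ?smeetKj ?smeetKj_r. Qed.

Lemma nat_succeq_trans y x z :
  nat_succeq x y -> nat_succeq y z -> nat_succeq x z.
Proof.
rewrite /nat_succeq => yxy zyz.
apply: (@band_sandwich S (@smeet S) (z ⊓ y) x (y ⊓ z)).
- exact: smeetA.
- exact: smeetxx.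
by rewrite -{1}zyz -{1}yxy !smeetA.
Qed.

Lemma nat_succeq_meet x y : nat_succeq x (x ⊓ y) /\ nat_succeq y (x ⊓ y).
Proof. by rewrite /nat_succeq !smeetA !smeet2 -smeetA smeetxx. Qed.

(** From [y ⊓ x ⊓ y = y] follows [y ⊔ (x ⊓ y) = x ⊓ y], so [x = x ⊔ (x ⊓ y) = x ⊔ y ⊔ (x ⊓ y)]
    factors through [y] under [⊔]. *)
Lemma nat_succeq_join x y : nat_succeq x y -> x ⊔ y ⊔ x = x.
Proof.
move=> yxy; apply: (@band_sandwich S (@sjoin S) x y (x ⊓ y)).
- exact: sjoinA.
- exact: sjoinxx.
have yu : y ⊔ (x ⊓ y) = x ⊓ y by apply/sjoin_smeet_eq; rewrite smeetA.
by rewrite -sjoinA yu sjoinKm.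
Qed.

End Preorder.

Lemma nat_succeq_dual (S : skewLatticeType) (x y : S) :
  @nat_succeq (dual_skew S) y x <-> nat_succeq x y.
Proof.
split; last exact: nat_succeq_join.
exact: (@nat_succeq_join (dual_skew S)).
Qed.

Lemma relD_dual (S : skewLatticeType) (x y : S) :
  @relD (dual_skew S) x y <-> relD x y.
Proof. by rewrite /relD !nat_succeq_dual; split=> -[]. Qed.

Lemma is_Dclass_dual (S : skewLatticeType) (A : set S) :
  is_Dclass A -> @is_Dclass (dual_skew S) A.
Proof.
by case=> x ->; exists x; apply/seteqP; split=> y /relD_dual.
Qed.

(** * D-classes as rectangular algebras, and comparable pairs of them *)

Section Dclass.
Variables (S : skewLatticeType) (A : set S).
Hypothesis hA : is_Dclass A.
Implicit Types (x y z : S) (X : set S).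

Lemma Dclass_relD x y : A x -> A y -> relD x y.
Proof.
case: hA => t -> /= [tx xt] [ty yt].
by split; [apply: nat_succeq_trans ty | apply: nat_succeq_trans tx].
Qed.

Lemma Dclass_closed x y : A x -> relD x y -> A y.
Proof.
case: hA => t -> /= [tx xt] [xy yx].
by split; [apply: nat_succeq_trans xy | apply: nat_succeq_trans xt].
Qed.

Lemma Dclass_smeet_rect x y : A x -> A y -> x ⊓ y ⊓ x = x.
Proof. by move=> Ax Ay; case: (Dclass_relD Ax Ay). Qed.

Lemma Dclass_smeet x y : A x -> A y -> A (x ⊓ y).
Proof.
move=> Ax Ay; apply: (Dclass_closed Ax); split.
  by case: (nat_succeq_meet x y).
by rewrite /nat_succeq smeetA smeetxx Dclass_smeet_rect.
Qed.

End Dclass.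

Lemma Dclass_sjoin (S : skewLatticeType) (A : set S) (x y : S) :
  is_Dclass A -> A x -> A y -> A (x ⊔ y).
Proof. by move=> /is_Dclass_dual hA; apply: (Dclass_smeet hA). Qed.

(** With [u = x ⊔ y], absorption gives [u ⊓ y = y] and [x ⊓ u = x], so [y ⊓ x = u ⊓ (y ⊓ x) ⊓ u],
    which is [u] by rectangularity. *)
Lemma Dclass_sjoinE (S : skewLatticeType) (A : set S) (x y : S) :
  is_Dclass A -> A x -> A y -> x ⊔ y = y ⊓ x.
Proof.
move=> hA Ax Ay.
have Au := Dclass_sjoin hA Ax Ay.
have -> : y ⊓ x = (x ⊔ y) ⊓ (y ⊓ x) ⊓ (x ⊔ y).
  by rewrite smeetA sjoinKm_r -smeetA smeetKj.
by rewrite (Dclass_smeet_rect hA) //; apply: Dclass_smeet.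
Qed.

(** Rectangularity is inherited from [B] and joins in [B] are reversed meets, so for cosets and
    image sets only closure under [⊓] remains to be checked. *)
Lemma Dclass_rectangular_subalgebra (S : skewLatticeType) (B X : set S) :
  is_Dclass B -> X `<=` B -> closed_under (@smeet S) X ->
  rectangular_subalgebra B X.
Proof.
move=> hB XB Xmeet.
have Xjoin : closed_under (@sjoin S) X.
  move=> x y Xx Xy.
  by rewrite (Dclass_sjoinE hB) //; [exact: Xmeet|exact: XB..].
split=> //; split.
- by split=> // *; rewrite ?smeetA ?smeetxx.
- by move=> x y /XB Bx /XB By; rewrite (Dclass_smeet_rect hB).
- by split=> // *; rewrite ?sjoinA ?sjoinxx.
- move=> x y /XB Bx /XB By.
  exact: (Dclass_smeet_rect (is_Dclass_dual hB) Bx By).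
Qed.

Lemma rectangular_subalgebra_dual (S : skewLatticeType) (B X : set S) :
  @rectangular_subalgebra (dual_skew S) B X -> rectangular_subalgebra B X.
Proof. by case=> XB [Xj Xm] rj rm; split. Qed.

(** Rectangularity, used twice: [x ⊓ y ⊓ z = x ⊓ y ⊓ (z ⊓ x ⊓ z) = (x ⊓ (y ⊓ z) ⊓ x) ⊓ z]. *)
Lemma Dclass_smeet_mid (S : skewLatticeType) (A : set S) (x y z : S) :
  is_Dclass A -> A x -> A y -> A z -> x ⊓ y ⊓ z = x ⊓ z.
Proof.
move=> hA Ax Ay Az.
rewrite -{1}(Dclass_smeet_rect hA Az Ax) !smeetA -(smeetA x y).
by rewrite (Dclass_smeet_rect hA) //; apply: Dclass_smeet.
Qed.

(** An elementwise form of the comparison: unlike [Dgt], which refers to the meet of the quotient,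
    it passes to the dual one pair at a time. *)
Definition Dclass_succeq (S : skewLatticeType) (A B : set S) : Prop :=
  [/\ is_Dclass A, is_Dclass B & forall a b, A a -> B b -> nat_succeq a b].

Lemma Dclass_succeq_dual (S : skewLatticeType) (A B : set S) :
  Dclass_succeq A B -> @Dclass_succeq (dual_skew S) B A.
Proof.
case=> hA hB AB; split; [exact: is_Dclass_dual..|move=> b a Bb Aa].
by apply/nat_succeq_dual; apply: AB.
Qed.

Lemma Dgt_Dclass_succeq (S : skewLatticeType) (A B : set S) :
  is_Dclass A -> is_Dclass B -> Dgt A B -> Dclass_succeq A B.
Proof.
move=> hA hB [AB _]; split=> // a b Aa Bb.
(* [a ⊓ b] lies in [Dmeet A B], which is [B]; so [b] is below [a ⊓ b] in the preorder, hence below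
   [a]. *)
have Bab : B (a ⊓ b).
  by rewrite -AB; exists a, b; split=> //; split; rewrite /nat_succeq !smeetxx.
have [a_ab _] := nat_succeq_meet a b.
by apply: nat_succeq_trans a_ab _; case: (Dclass_relD hB Bab Bb).
Qed.

Lemma meet_sandwich_lower (S : skewLatticeType) (A B : set S) (a b : S) :
  Dclass_succeq A B -> A a -> B b -> B (a ⊓ b ⊓ a).
Proof.
move=> [hA hB AB] Aa Bb; have bab := AB _ _ Aa Bb.
apply: (Dclass_closed hB Bb); split; rewrite /nat_succeq !smeetA.
  by rewrite !smeet4.
by rewrite !bab.
Qed.

Lemma smeet_upper_absorbl (S : skewLatticeType) (A B : set S) (a c b : S) :
  Dclass_succeq A B -> A a -> A c -> B b -> a ⊓ c ⊓ b = a ⊓ b.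
Proof.
move=> AB Aa Ac Bb; have [hA _ _] := AB.
have Aw : A (b ⊔ c ⊔ b).
  exact: (meet_sandwich_lower (Dclass_succeq_dual AB) Bb Ac).
have := sjoinKm_r b (b ⊔ c); move: (b ⊔ c ⊔ b) Aw => w Aw wb.
by rewrite -wb !smeetA (Dclass_smeet_mid hA Aa Ac Aw).
Qed.

Lemma smeet_upper_absorbr (S : skewLatticeType) (A B : set S) (a c b : S) :
  Dclass_succeq A B -> A a -> A c -> B b -> b ⊓ c ⊓ a = b ⊓ a.
Proof.
move=> AB Aa Ac Bb; have [hA _ _] := AB.
have Aw : A (b ⊔ c ⊔ b).
  exact: (meet_sandwich_lower (Dclass_succeq_dual AB) Bb Ac).
have : b ⊓ (b ⊔ c ⊔ b) = b by rewrite -sjoinA smeetKj.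
move: (b ⊔ c ⊔ b) Aw => w Aw bw.
by rewrite -bw -!(smeetA b) (Dclass_smeet_mid hA Aw Ac Aa).
Qed.

(** * Cosets and image sets in the lower class *)

Section ComparableClasses.
Variables (S : skewLatticeType) (A B : set S).
Hypothesis AB : Dclass_succeq A B.
Implicit Types a b c x y : S.

Let hA : is_Dclass A. Proof. by case: AB. Qed.
Let hB : is_Dclass B. Proof. by case: AB. Qed.

(** Both sides equal [a ⊓ b ⊓ c]: the left because [b ⊓ (a ⊓ c) ⊓ b = b], the right by absorbing the
    inner factors from [A]. This gives closure of cosets and also multiplicativity of the coset
    bijection. *)
Lemma sandwich_smeet a c b : A a -> A c -> B b ->
  (a ⊓ b ⊓ a) ⊓ (c ⊓ b ⊓ c) = (a ⊓ c) ⊓ b ⊓ (a ⊓ c).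
Proof.
move=> Aa Ac Bb; have [_ _ geAB] := AB.
have -> : (a ⊓ c) ⊓ b ⊓ (a ⊓ c) = a ⊓ b ⊓ c.
  rewrite (smeet_upper_absorbl AB Aa Ac Bb) -!(smeetA a b) (smeetA b a c).
  by rewrite (smeet_upper_absorbr AB Ac Aa Bb).
have bacb : b ⊓ (a ⊓ c) ⊓ b = b by exact: geAB (Dclass_smeet hA Aa Ac) Bb.
by rewrite -[in RHS]bacb !smeetA.
Qed.

Lemma meet_coset_rectangular b :
  B b -> rectangular_subalgebra B (meet_coset A b).
Proof.
move=> Bb; apply: (Dclass_rectangular_subalgebra hB).
  by move=> _ [a Aa <-]; apply: meet_sandwich_lower AB Aa Bb.
move=> _ _ [a Aa <-] [c Ac <-]; exists (a ⊓ c); first exact: Dclass_smeet.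
by rewrite sandwich_smeet.
Qed.

Lemma meet_image_rectangular a :
  A a -> rectangular_subalgebra B (meet_image B a).
Proof.
move=> Aa; apply: (Dclass_rectangular_subalgebra hB).
  by move=> _ [b Bb <-]; apply: meet_sandwich_lower AB Aa Bb.
(* The product is [a ⊓ b ⊓ a ⊓ c ⊓ a]. Grouping [a ⊓ c ⊓ a], already known to lie in [B], keeps the
   witness in [B]. *)
move=> _ _ [b Bb <-] [c Bc <-]; exists (b ⊓ (a ⊓ c ⊓ a)).
  by apply: Dclass_smeet => //; apply: meet_sandwich_lower AB Aa Bc.
by rewrite !smeetA !smeet2.
Qed.

(** If [y = c ⊓ b ⊓ c] is below [x], then [y = x ⊓ y ⊓ x = x ⊓ c ⊓ b ⊓ c ⊓ x], and both [c] are
    absorbed. *)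
Lemma sandwich_eqP b x y : B b -> A x -> meet_coset A b y ->
  x ⊓ b ⊓ x = y <-> nat_ge x y.
Proof.
move=> Bb Ax [c Ac <-]; split=> [<-|[xy yx]].
  by rewrite /nat_ge !smeetA smeetxx smeet2.
rewrite -yx -xy !smeetA (smeet_upper_absorbl AB Ax Ac Bb).
by rewrite -!(smeetA x) (smeet_upper_absorbr AB Ax Ac Bb).
Qed.

End ComparableClasses.

(** * The coset bijection *)

Lemma nat_ge_dual (S : skewLatticeType) (x y : S) :
  @nat_ge (dual_skew S) y x <-> nat_ge x y.
Proof.
split=> -[xy yx]; split.
- by rewrite -[x]yx; apply: sjoinKm_r.
- by rewrite -[x]xy; apply: smeetKj.
- by rewrite -[y]yx; apply: (@smeetKj_r S).
- by rewrite -[y]xy; apply: (@sjoinKm S).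
Qed.

Lemma coset_bijection_iso (S : skewLatticeType) (A B : set S) (a b : S) :
  Dclass_succeq A B -> A a -> B b ->
  isomorphism_on (join_coset B a) (meet_coset A b) (coset_bijection b).
Proof.
move=> AB Aa Bb; have BA := Dclass_succeq_dual AB; have [hA hB _] := AB.
have cosetA x : join_coset B a x -> A x.
  by case=> c Bc <-; apply: meet_sandwich_lower BA Bc Aa.
(* Together with its dual, this describes [x ⊓ b ⊓ x = y] and [y ⊔ a ⊔ y = x] by the same relation
   [nat_ge x y], so the two maps are mutually inverse between the cosets. *)
have cosetP x y := @sandwich_eqP S A B AB b x y Bb.
have cosetP' y x := @sandwich_eqP (dual_skew S) B A BA a y x Aa.
have mem_meet x : A x -> meet_coset A b (coset_bijection b x).
  by move=> Ax; exists x.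
have inB x : A x -> B (coset_bijection b x).
  by move=> Ax; exact: (meet_sandwich_lower AB Ax Bb).
split; first split.
- by move=> x /cosetA; apply: mem_meet.
- move=> x x' /set_mem xC /set_mem x'C fxx'.
  have [Ax Ax'] := (cosetA _ xC, cosetA _ x'C).
  have /nat_ge_dual gex : nat_ge x (coset_bijection b x).
    by apply/cosetP => //; apply: mem_meet.
  have /nat_ge_dual gex' : nat_ge x' (coset_bijection b x).
    by apply/cosetP => //; apply: mem_meet.
  rewrite -(proj2 (cosetP' _ _ (inB _ Ax) xC) gex).
  by rewrite -(proj2 (cosetP' _ _ (inB _ Ax) x'C) gex').
- move=> y yC; have [c Ac yE] := yC.
  have By : B y by rewrite -yE; apply: meet_sandwich_lower AB Ac Bb.
  have xC : join_coset B a (y ⊔ a ⊔ y) by exists y.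
  exists (y ⊔ a ⊔ y) => //; apply/cosetP => //; first exact: cosetA.
  by apply/nat_ge_dual/(cosetP' _ _ By xC).
- move=> x y /cosetA Ax /cosetA Ay.
  by rewrite /coset_bijection (sandwich_smeet AB).
- move=> x y /cosetA Ax /cosetA Ay.
  rewrite (Dclass_sjoinE hA) // (Dclass_sjoinE hB); [|exact: inB..].
  by rewrite /coset_bijection (sandwich_smeet AB).
Qed.

Theorem proposition5 (S : skewLatticeType) (A B : set S)
    (hA : is_Dclass A) (hB : is_Dclass B) (hAB : Dgt A B) :
  [/\ forall b : S, B b -> rectangular_subalgebra B (meet_coset A b),
      forall a : S, A a -> rectangular_subalgebra B (meet_image B a),
      forall a : S, A a -> rectangular_subalgebra A (join_coset B a),
      forall b : S, B b -> rectangular_subalgebra A (join_image A b)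
    & forall a b : S, A a -> B b ->
        (forall x y : S, join_coset B a x -> meet_coset A b y ->
           (coset_bijection b x = y <-> nat_ge x y)) /\
        isomorphism_on (join_coset B a) (meet_coset A b) (coset_bijection b)].
Proof.
have AB := Dgt_Dclass_succeq hA hB hAB; have BA := Dclass_succeq_dual AB.
split.
- exact: meet_coset_rectangular.
- exact: meet_image_rectangular.
(* Over the dual, [meet_coset] and [meet_image] unfold to [join_coset] and [join_image] over [S]. *)
- move=> a Aa; apply: rectangular_subalgebra_dual.
  exact: (meet_coset_rectangular BA).
- move=> b Bb; apply: rectangular_subalgebra_dual.
  exact: (meet_image_rectangular BA).
- move=> a b Aa Bb; split; last exact: coset_bijection_iso.
  move=> x y [c Bc <-] yC; apply: (sandwich_eqP AB) => //.
  exact: (meet_sandwich_lower BA Bc Aa).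
Qed.
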